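(* Let $\mathcal{Q}$ be a smooth manifold, let $F$ be a Morse family on the total space of a fiber bundle $P\to\mathcal{T}^*\mathcal{Q}$, with bundle coordinates $(q^i,p_i,z,\lambda^a)$ on $P$, and let $\mathcal{S}_F\subset\mathfrak{H}\mathcal{T}^*\mathcal{Q}\times\mathbb{R}$ be the (possibly non-horizontal) Lagrangian submanifold generated by $F$ (implicit evolution Hamiltonian dynamics). Let $W=W(q)$ be a real-valued (smooth) function on $\mathcal{Q}$ with first prolongation $\mathcal{T}^*W:\mathcal{Q}\to\mathcal{T}^*\mathcal{Q}$, and let $\mathcal{S}_F|_{\mathrm{im}(\mathcal{T}^*W)}\subset\mathfrak{H}\mathcal{T}^*\mathcal{Q}\times\mathbb{R}$ and $\mathcal{S}_F^{\mathcal{T}^*W}\subset T\mathcal{Q}$ be the associated restricted and projected submanifolds. Then the following two conditions are equivalent: 1. $\mathcal{S}_F$ and $\mathcal{S}_F^{\mathcal{T}^*W}$ are $\mathcal{T}^*W$-related, that is, $$T\mathcal{T}^*W\big(\mathcal{S}_F^{\mathcal{T}^*W}\big)=\mathcal{S}_F|_{\mathrm{im}(\mathcal{T}^*W)},$$ where $T\mathcal{T}^*W:T\mathcal{Q}\to T\mathcal{T}^*\mathcal{Q}$ is the tangent map of $\mathcal{T}^*W$ and the right-hand side is regarded as a subset of $\mathfrak{H}\mathcal{T}^*\mathcal{Q}\subset T\mathcal{T}^*\mathcal{Q}$ by forgetting the $\mathbb{R}$-component $u$. 2. $dF\big(q^i,\tfrac{\partial W}{\partial q^i},W,\lambda^a\big)=0$,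 that is, the differential of the function $(q,\lambda)\mapsto F\big(q^i,\tfrac{\partial W}{\partial q^i}(q),W(q),\lambda^a\big)$ vanishes.
   Context: $\mathcal{T}^*\mathcal{Q}=T^*\mathcal{Q}\times\mathbb{R}$ carries the contact form $\eta_{\mathcal{Q}}=dz-p_i\,dq^i$ in Darboux coordinates $(q^i,p_i,z)$. Let $\mathfrak{H}\mathcal{T}^*\mathcal{Q}=\ker\eta_{\mathcal{Q}}\subset T\mathcal{T}^*\mathcal{Q}$. On $\mathfrak{H}\mathcal{T}^*\mathcal{Q}\times\mathbb{R}$ use coordinates $(q^i,p_i,z,\dot q^i,\dot p_i,u)$; the corresponding vector in $T\mathcal{T}^*\mathcal{Q}$ has components $(\dot q^i,\dot p_i,\dot z=p_i\dot q^i)$. It is a symplectic manifold with symplectic form $\omega_\eta=d\theta_\eta$, where $\theta_\eta$ is the pull-back to $\mathfrak{H}\mathcal{T}^*\mathcal{Q}\times\mathbb{R}$ of the one-form $d\dot z+u\,dz-(\dot p_i+up_i)\,dq^i-p_i\,d\dot q^i$ on $T\mathcal{T}^*\mathcal{Q}\times\mathbb{R}$, i.e. $\theta_\eta=u\,dz-(\dot p_i+up_i)\,dq^i+\dot q^i\,dp_i$. A Morse family on a fiber bundle $\tau:P\to\mathcal{M}$ is a function $F:P\to\mathbb{R}$ such that $T_w\,\mathrm{im}(dF)+T_wV^0P=T_wT^*P$ for all $w\in\mathrm{im}(dF)\cap V^0P$, where $V^0P\subset T^*P$ consists of the covectors annihilating $\ker T\tau$. The Lagrangian submanifold of $\mathfrak{H}\mathcal{T}^*\mathcal{Q}\times\mathbb{R}$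 generated by $F$ is $$\mathcal{S}_F=\Big\{\big(q^i,p_i,z;\tfrac{\partial F}{\partial p_i},-\tfrac{\partial F}{\partial q^i}-p_i\tfrac{\partial F}{\partial z},\tfrac{\partial F}{\partial z}\big):\tfrac{\partial F}{\partial\lambda^a}=0\Big\},$$ with derivatives evaluated at $(q,p,z,\lambda)$; the entries after the semicolon are $(\dot q^i,\dot p_i,u)$. The first prolongation of $W$ is $\mathcal{T}^*W:\mathcal{Q}\to\mathcal{T}^*\mathcal{Q}$, $(q^i)\mapsto(q^i,\partial W/\partial q^i,W(q))$. Write $|_{\mathrm{im}(\mathcal{T}^*W)}$ for evaluation at $p_i=\partial W/\partial q^i$, $z=W(q)$. The restriction of $\mathcal{S}_F$ to the image of $\mathcal{T}^*W$ is $$\mathcal{S}_F|_{\mathrm{im}(\mathcal{T}^*W)}=\Big\{\big(q^i,\tfrac{\partial W}{\partial q^i},W(q);\tfrac{\partial F}{\partial p_i},-\tfrac{\partial F}{\partial q^i}-\tfrac{\partial W}{\partial q^i}\tfrac{\partial F}{\partial z},\tfrac{\partial F}{\partial z}\big)\Big|_{\mathrm{im}(\mathcal{T}^*W)}:\tfrac{\partial F}{\partial\lambda^a}\Big|_{\mathrm{im}(\mathcal{T}^*W)}=0\Big\},$$ and its projection to $T\mathcal{Q}$ under $(q^i,p_i,z,\dot q^i,\dot p_i,u)\mapsto(q^i,\dot q^i)$ is $$\mathcal{S}_F^{\mathcal{T}^*W}=\Big\{\big(q^i,\tfrac{\partial F}{\partial p_i}\big|_{\mathrm{im}(\mathcal{T}^*W)}\big)\in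 T\mathcal{Q}:\tfrac{\partial F}{\partial\lambda^a}\Big|_{\mathrm{im}(\mathcal{T}^*W)}=0\Big\}.$$ In local coordinates, condition 2 is read as the implicit evolution Hamilton-Jacobi equation $F\big(q^i,\tfrac{\partial W}{\partial q^i},W(q),\lambda^a\big)=c$, with $c$ a constant of integration.
   Formalization: Condition 2 is required only at points (q,λ) where ∂F/∂λ=0 on im(T*W), i.e. those parametrizing the restricted S_F; at all (q,λ) the implication 1⇒2 fails, e.g. F=λ²/2, W=0. *)

(* Defs.v *)
From HB Require Import structures.
From mathcomp Require Import all_boot all_order all_algebra.
From mathcomp Require Import all_classical all_reals all_analysis.

Set Implicit Arguments.
Unset Strict Implicit.
Unset Printing Implicit Defensive.

Import Order.TTheory GRing.Theory Num.Theory.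
Import numFieldNormedType.Exports.
Local Open Scope classical_set_scope.
Local Open Scope ring_scope.

Section Calculus.
Variable R : realType.

(* C^oo on U (meant for open U): all iterated directional derivatives are
   Frechet differentiable, hence continuous, at every point of U. *)
Definition smooth_on (V V' : normedModType R) (U : set V) (f : V -> V') :=
  forall (vs : seq V) (x : V), U x ->
    differentiable (foldr (fun v g => fun y => 'D_v g y) f vs) x.

Definition pairing m (p v : 'rV[R]_m) : R := \sum_i p 0 i * v 0 i.

Definition grad m (f : 'rV[R]_m -> R) (a : 'rV[R]_m) : 'rV[R]_m :=
  \row_i 'D_(delta_mx 0 i) f a.

End Calculus.

(* Smooth manifolds.  The topology is the one induced by the atlas, so that a
   manifold is given by a bare type and an atlas.  A tangent vector, resp. a
   covector, at x is encoded by its components in the distinguished chart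
   [chart_at A x], so that TM and T*M are both encoded by M * 'rV_m (as plain
   types: their topologies are not the product ones). *)
Section Manifolds.
Variable R : realType.

Record chart (M : Type) (m : nat) := Chart {
  cdom : set M;
  cmap :> M -> 'rV[R]_m;
  cinv : 'rV[R]_m -> M }.

Record atlas (M : Type) (m : nat) := Atlas {
  charts : set (chart M m);
  chart_at : M -> chart M m }.

Definition is_chart M m (c : chart M m) :=
  open (c @` cdom c) /\ forall x, cdom c x -> cinv c (c x) = x.

Definition compatible M m (c c' : chart M m) :=
  open (c @` (cdom c `&` cdom c')) /\
  smooth_on (c @` (cdom c `&` cdom c')) (c' \o cinv c).

Definition aopen M m (A : atlas M m) (U : set M) :=
  forall c, charts A c -> open (c @` (cdom c `&` U)).

Definition is_manifold M m (A : atlas M m) :=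
  [/\ forall c, charts A c -> is_chart c,
      forall x, charts A (chart_at A x) /\ cdom (chart_at A x) x,
      forall c c', charts A c -> charts A c' -> compatible c c',
      (* Hausdorff *)
      forall x y, x <> y -> exists U V : set M,
        [/\ aopen A U, aopen A V, U x, V y & U `&` V = set0] &
      (* second countable *)
      exists B : nat -> set M, (forall i, aopen A (B i)) /\
        forall U x, aopen A U -> U x -> exists i, B i x /\ B i `<=` U].

(* The charts of the maximal atlas. *)
Definition smooth_chart M m (A : atlas M m) (c : chart M m) :=
  is_chart c /\
  forall c', charts A c' -> compatible c c' /\ compatible c' c.

Definition smooth_fun M m (A : atlas M m) (f : M -> R) :=
  forall c, charts A c -> smooth_on (c @` cdom c) (f \o cinv c).

(* Openness of the sets below says that f is continuous on O. *)
Definition smooth_map_on M m (A : atlas M m) N m' (B : atlas N m')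
    (O : set M) (f : M -> N) :=
  aopen A O /\
  forall c c', charts A c -> charts B c' ->
    let U := c @` (cdom c `&` O `&` f @^-1` cdom c') in
    open U /\ smooth_on U (c' \o f \o cinv c).

Definition tangent_map M m (A : atlas M m) N m' (B : atlas N m') (f : M -> N)
    (X : M * 'rV[R]_m) : N * 'rV[R]_m' :=
  (f X.1, 'd (chart_at B (f X.1) \o f \o cinv (chart_at A X.1))
             (chart_at A X.1 X.1) X.2).

Definition differential M m (A : atlas M m) (f : M -> R) (x : M) :
    M * 'rV[R]_m :=
  (x, grad (f \o cinv (chart_at A x)) (chart_at A x x)).

(* Tangent space at w of a subset S: velocities of the smooth curves in S. *)
Definition tangent_to M m (A : atlas M m) (S : set M) (w : M) :
    set 'rV[R]_m :=
  [set v | exists (g : R -> M) (I : set R),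
     [/\ open I, I 0, g 0 = w,
         forall t, I t -> S (g t) /\ cdom (chart_at A w) (g t) &
         smooth_on I (chart_at A w \o g) /\ 'D_1 (chart_at A w \o g) 0 = v]].

Definition line_chart : chart R 1 := Chart setT (fun t => const_mx t) (fun a => a 0 0).

Definition line_atlas : atlas R 1 := Atlas [set line_chart] (fun=> line_chart).

Definition prod_chart M m N m' (c : chart M m) (c' : chart N m') :
    chart (M * N) (m + m') :=
  Chart (cdom c `*` cdom c')
        (fun w => row_mx (c w.1) (c' w.2))
        (fun a => (cinv c (lsubmx a), cinv c' (rsubmx a))).

Definition prod_atlas M m N m' (A : atlas M m) (B : atlas N m') :
    atlas (M * N) (m + m') :=
  Atlas [set d | exists c c', [/\ charts A c, charts B c' & d = prod_chart c c']]
        (fun w => prod_chart (chart_at A w.1) (chart_at B w.2)).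

(* Components in c' of the covector at x with components p in c. *)
Definition covector_change M m (c c' : chart M m) (x : M) (p : 'rV[R]_m) :
    'rV[R]_m :=
  \row_i pairing p ('D_(delta_mx 0 i) (c \o cinv c') (c' x)).

Definition cotangent_chart M m (A : atlas M m) (c : chart M m) :
    chart (M * 'rV[R]_m) (m + m) :=
  Chart [set w | cdom c w.1]
        (fun w => row_mx (c w.1) (covector_change (chart_at A w.1) c w.1 w.2))
        (fun a => let x := cinv c (lsubmx a) in
           (x, covector_change c (chart_at A x) x (rsubmx a))).

Definition cotangent_atlas M m (A : atlas M m) : atlas (M * 'rV[R]_m) (m + m) :=
  Atlas [set d | exists2 c, charts A c & d = cotangent_chart A c]
        (fun w => cotangent_chart A (chart_at A w.1)).

End Manifolds.

Section Bundles.
Variable R : realType.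
Variables (P B T : Type) (m b k : nat).
Variables (AP : atlas R P m) (AB : atlas R B b) (AT : atlas R T k).
Variable tau : P -> B.

(* Smooth local triviality, with typical fibre T. *)
Definition fiber_bundle :=
  forall x : B, exists U : set B, [/\ aopen AB U, U x &
    exists (phi : P -> T) (psi : B * T -> P),
      [/\ forall y, U (tau y) -> psi (tau y, phi y) = y,
          forall z t, U z -> tau (psi (z, t)) = z /\ phi (psi (z, t)) = t,
          smooth_map_on AP (prod_atlas AB AT) (tau @^-1` U)
            (fun y => (tau y, phi y)) &
          smooth_map_on (prod_atlas AB AT) AP (U `*` setT) psi]].

(* The covectors on P annihilating the kernel of the tangent map of tau. *)
Definition conormal : set (P * 'rV[R]_m) :=
  [set w | forall v, (tangent_map AP AB tau (w.1, v)).2 = 0 ->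
             pairing w.2 v = 0].

Definition morse_family (F : P -> R) :=
  smooth_fun AP F /\
  forall w, range (differential AP F) w -> conormal w ->
    forall v : 'rV[R]_(m + m), exists v1 v2,
      [/\ tangent_to (cotangent_atlas AP) (range (differential AP F)) w v1,
          tangent_to (cotangent_atlas AP) conormal w v2 & v = v1 + v2].

End Bundles.

Section ContactHamiltonJacobi.
Variable R : realType.
Variables (n k : nat) (Q : Type) (AQ : atlas R Q n).

(* The extended cotangent bundle T*Q x R, of dimension 2n+1. *)
Definition extcot : Type := Q * 'rV[R]_n * R.

Definition extcot_atlas : atlas R extcot (n + n + 1) :=
  prod_atlas (cotangent_atlas AQ) (line_atlas R).

(* The Darboux coordinates (q, p, z) on T*Q x R induced by a chart of Q. *)
Definition darboux_chart (c : chart R Q n) : chart R extcot (n + n + 1) :=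
  prod_chart (cotangent_chart AQ c) (line_chart R).

Definition base_pt (w : extcot) : Q := w.1.1.
Definition momentum (w : extcot) : 'rV[R]_n := w.1.2.

Definition qpart (a : 'rV[R]_(n + n + 1)) : 'rV[R]_n := lsubmx (lsubmx a).
Definition ppart (a : 'rV[R]_(n + n + 1)) : 'rV[R]_n := rsubmx (lsubmx a).
Definition zpart (a : 'rV[R]_(n + n + 1)) : R := rsubmx a 0 0.

(* T(T*Q x R); the distinguished chart at w is
   darboux_chart (chart_at AQ (base_pt w)), so that X.2 consists of the
   components (qdot, pdot, zdot) of X. *)
Definition T_extcot : Type := extcot * 'rV[R]_(n + n + 1).

(* eta = dz - p_i dq^i *)
Definition contact_form (X : T_extcot) : R :=
  zpart X.2 - pairing (momentum X.1) (qpart X.2).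

Definition horizontal : set T_extcot := [set X | contact_form X = 0].

Variables (P : Type) (AP : atlas R P (n + n + 1 + k)) (tau : P -> extcot).

(* Bundle coordinates (q, p, z, lambda) around y, over the Darboux coordinates
   induced by c. *)
Definition bundle_chart (c : chart R Q n) (psi : chart R P (n + n + 1 + k))
    (y : P) :=
  [/\ smooth_chart AP psi, cdom psi y &
      forall y', cdom psi y' -> cdom (darboux_chart c) (tau y') /\
                                lsubmx (psi y') = darboux_chart c (tau y')].

Variable F : P -> R.

Definition local_grad (psi : chart R P (n + n + 1 + k)) (y : P) :=
  grad (F \o cinv psi) (psi y).
Definition dF_q psi y : 'rV[R]_n := qpart (lsubmx (local_grad psi y)).
Definition dF_p psi y : 'rV[R]_n := ppart (lsubmx (local_grad psi y)).
Definition dF_z psi y : R := zpart (lsubmx (local_grad psi y)).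
Definition dF_lambda psi y : 'rV[R]_k := rsubmx (local_grad psi y).

(* The submanifold S_F of ker eta x R generated by F.  Its elements are pairs
   (X, u); zdot is determined by horizontality. *)
Definition generated : set (T_extcot * R) :=
  [set Xu | let X := Xu.1 in let w := X.1 in
     horizontal X /\
     exists y psi, [/\ tau y = w,
       bundle_chart (chart_at AQ (base_pt w)) psi y,
       dF_lambda psi y = 0 &
       [/\ qpart X.2 = dF_p psi y,
           ppart X.2 = - dF_q psi y - dF_z psi y *: momentum w &
           Xu.2 = dF_z psi y]]].

Variable W : Q -> R.

(* First prolongation: x |-> (x, dW(x), W(x)). *)
Definition prolong (x : Q) : extcot := (differential AQ W x, W x).

Definition restricted : set (T_extcot * R) :=
  generated `&` [set Xu | range prolong Xu.1.1].

(* (q, p, z, qdot, pdot, u) |-> (q, qdot), into TQ. *)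
Definition to_TQ (Xu : T_extcot * R) : Q * 'rV[R]_n :=
  (base_pt Xu.1.1, qpart Xu.1.2).

Definition projected : set (Q * 'rV[R]_n) := to_TQ @` restricted.

Definition prolong_related :=
  tangent_map AQ extcot_atlas prolong @` projected = fst @` restricted.

(* (q, lambda) |-> F(q, dW/dq, W(q), lambda) in bundle coordinates psi over the
   Darboux coordinates induced by c. *)
Definition F_prolong (c : chart R Q n) (psi : chart R P (n + n + 1 + k))
    (s : 'rV[R]_(n + k)) : R :=
  F (cinv psi (row_mx (darboux_chart c (prolong (cinv c (lsubmx s))))
                      (rsubmx s))).

(* Implicit evolution Hamilton-Jacobi equation d(F(q, dW/dq, W, lambda)) = 0,
   with both the q- and the lambda-components of the differential, imposed at
   the points (q, lambda) where dF/dlambda = 0, i.e. those parametrizing S_F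
   over the image of the prolongation.  Elsewhere the lambda-components do not
   vanish whatever W is, while no element of S_F arises: imposed at all
   (q, lambda), the equation would fail for F = lambda^2 / 2 and W = 0, for
   which prolong_related holds. *)
Definition hamilton_jacobi :=
  forall (x : Q) (y : P) (psi : chart R P (n + n + 1 + k)),
    tau y = prolong x -> bundle_chart (chart_at AQ x) psi y ->
    dF_lambda psi y = 0 ->
    grad (F_prolong (chart_at AQ x) psi)
         (row_mx (chart_at AQ x x) (rsubmx (psi y))) = 0.

End ContactHamiltonJacobi.

(* Main.v *)
(* In the chart c at x, put W_c = W \o cinv c; covariance of the differential
   makes the prolongation read a |-> (a, grad W_c a, W_c a).  Its tangent map sends
   v to (v, Hess W_c v, dW_c v), which is horizontal.  At a point of S_F over
   the prolongation, the relation therefore amounts to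
     Hess W_c F_p = - F_q - F_z grad W_c,
   whereas the chain rule gives F(q, dW, W, lambda) the gradient
     (F_q + (Hess W_c)^T F_p + F_z grad W_c, F_lambda).
   With F_lambda = 0, and Hess W_c symmetric, the two conditions agree point by
   point. *)
Require Import Defs.
From mathcomp Require Import all_boot all_order all_algebra.
From mathcomp Require Import all_classical all_reals all_analysis.

Set Implicit Arguments.
Unset Strict Implicit.
Unset Printing Implicit Defensive.
Import Order.TTheory GRing.Theory Num.Theory.
Import numFieldNormedType.Exports.
Local Open Scope classical_set_scope.
Local Open Scope ring_scope.

(** * Differentiability of vector- and matrix-valued maps *)

(** The difference [g - f] vanishes near [a], hence is differentiable there with zero differential.
    Identities between charts hold only near a point, which is where this is needed. *)
Lemma near_eq_differentiable (R : realType) (V V' : normedModType R)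
    (f g : V -> V') (a : V) :
  (\near a, f a = g a) -> differentiable f a -> differentiable g a.
Proof.
move=> fg df.
have h0 : differentiable (fun x => g x - f x) a.
  have h0 : (fun x => g x - f x) \o shift a =
      cst (g a - f a) + (\0 : {linear V -> V'}) +o_ 0 id.
    apply/eqaddoP => e e0; move: (fg); rewrite (near_shift 0 a) subr0.
    apply: filterS => x /= fgx.
    rewrite !fctE /= fgx (nbhs_singleton fg) !subrr addr0 subrr normr0.
    by rewrite mulr_ge0 // ltW.
  have c0 : continuous (\0 : {linear V -> V'}) by move=> ?; exact: cvg_cst.
  by apply/diff_locallyP; rewrite (diff_unique c0 h0).
have -> : g = f + (fun x => g x - f x) by apply/funext => x; rewrite !fctE addrC subrK.
exact: differentiableD.
Qed.

Lemma differentiable_mx (R : realType) (V : normedModType R) m n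
    (f : V -> 'M[R]_(m, n)) (a : V) :
  (forall i j, differentiable (fun x => f x i j) a) -> differentiable f a.
Proof.
move=> df.
have -> : f = \sum_i \sum_j (fun x => f x i j *: delta_mx i j).
  apply/funext => x; rewrite fct_sumE [LHS]matrix_sum_delta.
  by apply: eq_bigr => i _; rewrite fct_sumE.
apply: differentiable_sum => i; apply: differentiable_sum => j.
exact: differentiableZl.
Qed.

Lemma derive_mxE (R : realType) (V : normedModType R) m n
    (f : V -> 'M[R]_(m, n)) (a v : V) i j :
  differentiable f a -> ('D_v f a) i j = 'D_v (fun x => f x i j) a.
Proof. by move=> df; rewrite derive_mx ?mxE //; exact: diff_derivable. Qed.

Lemma differentiable_entry (R : realType) (V : normedModType R) m n
    (f : V -> 'M[R]_(m, n)) (a : V) i j :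
  differentiable f a -> differentiable (fun x => f x i j) a.
Proof.
move=> df; have E := @differentiable_coord R m n (f a) i j.
exact: (differentiable_comp df E).
Qed.

Lemma differentiable_row_mx (R : realType) (V : normedModType R) m n1 n2
    (f : V -> 'M[R]_(m, n1)) (g : V -> 'M[R]_(m, n2)) (a : V) :
  differentiable f a -> differentiable g a ->
  differentiable (fun x => row_mx (f x) (g x)) a.
Proof.
move=> df dg; apply: differentiable_mx => i j; case: (split_ordP j) => {}j ->.
  by under eq_fun do rewrite row_mxEl; exact: differentiable_entry.
by under eq_fun do rewrite row_mxEr; exact: differentiable_entry.
Qed.

Lemma derive_row_mx (R : realType) (V : normedModType R) m n1 n2
    (f : V -> 'M[R]_(m, n1)) (g : V -> 'M[R]_(m, n2)) (a v : V) :
  differentiable f a -> differentiable g a ->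
  'D_v (fun x => row_mx (f x) (g x)) a = row_mx ('D_v f a) ('D_v g a).
Proof.
move=> df dg; have dfg := differentiable_row_mx df dg.
apply/matrixP => i j; rewrite derive_mxE //; case: (split_ordP j) => {}j ->.
  by rewrite row_mxEl derive_mxE //; under eq_fun do rewrite row_mxEl.
by rewrite row_mxEr derive_mxE //; under eq_fun do rewrite row_mxEr.
Qed.

Lemma derive_grad (R : realType) m (f : 'rV[R]_m -> R) (a v : 'rV[R]_m) :
  differentiable f a -> 'D_v f a = pairing (grad f a) v.
Proof.
move=> df; rewrite deriveE // {1}(row_sum_delta v) linear_sum /pairing.
by apply: eq_bigr => i _; rewrite linearZ mxE -deriveE // mulrC.
Qed.

Lemma derive_comp (R : realType) (U V V' : normedModType R)
    (f : U -> V) (g : V -> V') (a v : U) :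
  differentiable f a -> differentiable g (f a) ->
  'D_v (g \o f) a = 'D_('D_v f a) g (f a).
Proof.
move=> df dg; rewrite deriveE; last exact: differentiable_comp.
by rewrite diff_comp //= -!deriveE.
Qed.

(** * Symmetry of second directional derivatives *)

Section SecondDerivatives.
Variables (R : realType) (V : normedModType R).

Lemma is_derive_ray (f : V -> R) (b v : V) (t : R) :
  differentiable f (b + t *: v) ->
  is_derive t (1 : R) (fun s => f (b + s *: v)) ('D_v f (b + t *: v)).
Proof.
move=> /(@diff_derivable _ _ _ _ _ v) df.
have E : (fun h : R => h^-1 *: (f (b + (h *: 1 + t) *: v) - f (b + t *: v))) =
         (fun h : R => h^-1 *: (f (h *: v + (b + t *: v)) - f (b + t *: v))).
  by apply/funext => h; rewrite [h *: 1]mulr1 scalerDl addrCA.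
by apply: DeriveDef; rewrite /derivable /derive /= E.
Qed.

Lemma mvt_from0 (f df : R -> R) (h : R) : 0 < h ->
  (forall t, 0 <= t <= h -> is_derive t (1 : R) f (df t)) ->
  exists t, 0 <= t <= h /\ f h - f 0 = h * df t.
Proof.
move=> h0 dfP.
have [||c] := @MVT _ f df _ _ h0.
- by move=> x; rewrite in_itv => /andP[/ltW x0 /ltW xh]; apply: dfP; rewrite x0.
- apply: derivable_within_continuous => x; rewrite in_itv /= => xh.
  by have [] := dfP _ xh.
rewrite in_itv => /andP[/ltW c0 /ltW ch] E; exists c; split; first by rewrite c0.
by rewrite E subr0 mulrC.
Qed.

(** The second difference is the increment over [[0, h]] of
    [f (a + h *: v + s *: u) - f (a + s *: u)] in [s]. The mean value theorem in [s], then in [t]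
    for ['D_u f], gives the two factors [h]. *)
Lemma second_difference_mvt (f : V -> R) (a u v : V) (h : R) : 0 < h ->
  (forall s t, 0 <= s <= h -> 0 <= t <= h ->
     differentiable f (a + s *: u + t *: v) /\
     differentiable ('D_u f) (a + s *: u + t *: v)) ->
  exists s t, [/\ 0 <= s <= h, 0 <= t <= h &
    f (a + h *: u + h *: v) - f (a + h *: u) - f (a + h *: v) + f a =
      h * (h * 'D_v ('D_u f) (a + s *: u + t *: v))].
Proof.
move=> h0 dfP.
have h00 : (0 : R) <= 0 <= h by rewrite lexx ltW.
have hh : 0 <= h <= h by rewrite lexx ltW.
have [s sh|s [sh E]] := @mvt_from0
  (fun s => f (a + h *: v + s *: u) - f (a + s *: u))
  (fun s => 'D_u f (a + h *: v + s *: u) - 'D_u f (a + s *: u)) _ h0.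
  apply: is_deriveB; apply: is_derive_ray.
    by rewrite addrAC; have [] := dfP _ _ sh hh.
  by have [] := dfP _ _ sh h00; rewrite scale0r addr0.
have [t th|t [th E']] := @mvt_from0
  (fun t => 'D_u f (a + s *: u + t *: v))
  (fun t => 'D_v ('D_u f) (a + s *: u + t *: v)) _ h0.
  by apply: is_derive_ray; have [] := dfP _ _ sh th.
exists s, t; split=> //.
rewrite -E' scale0r addr0 [a + s *: u + _]addrAC -E !scale0r !addr0.
by rewrite [a + h *: v + _]addrAC opprB addrA addrAC.
Qed.

(* Both mixed derivatives are limits, as h tends to 0, of the same second
   difference divided by h ^+ 2. *)
Lemma derive_swap (f : V -> R) (a u v : V) :
  (\forall x \near a, differentiable f x) ->
  (\forall x \near a, differentiable ('D_u f) x) ->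
  (\forall x \near a, differentiable ('D_v f) x) ->
  {for a, continuous ('D_v ('D_u f))} -> {for a, continuous ('D_u ('D_v f))} ->
  'D_v ('D_u f) a = 'D_u ('D_v f) a.
Proof.
move=> df du dv cuv cvu; apply/eqP/negPn/negP => ne.
set e := `|'D_v ('D_u f) a - 'D_u ('D_v f) a|.
have e0 : 0 < e / 2 by rewrite divr_gt0 // normr_gt0 subr_eq0.
move/cvgrPdist_lt : cuv => /(_ _ e0) cuv; move/cvgrPdist_lt : cvu => /(_ _ e0) cvu.
have nI := @filterI V (nbhs a) (nbhs_filter a).
have/nbhs_ballP[d /= d0 dP] := nI _ _ df (nI _ _ du (nI _ _ dv (nI _ _ cuv cvu))).
(* This keeps the parallelogram spanned by [h *: u] and [h *: v] at [a] within distance [d / 2] of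
   [a]; the summand 1 covers [u = v = 0]. *)
pose h := d / 2 / (`|u| + `|v| + 1).
have uv0 : 0 < `|u| + `|v| + 1 by rewrite ltr_wpDl // addr_ge0.
have h0 : 0 < h by rewrite !divr_gt0.
have inB s t : 0 <= s <= h -> 0 <= t <= h -> ball a d (a + s *: u + t *: v).
  move=> /andP[s0 sh] /andP[t0 th]; rewrite -ball_normE /=.
  rewrite -addrA opprD addNKr normrN.
  apply: (@le_lt_trans _ _ (h * `|u| + h * `|v|)).
    rewrite (le_trans (ler_normD _ _)) // !normrZ !ger0_norm //.
    by rewrite lerD // ler_wpM2r.
  apply: (@le_lt_trans _ _ (d / 2)); last by rewrite ltr_pdivrMr // ltr_pMr // ltr1n.
  by rewrite -mulrDr /h mulrAC ler_pdivrMr // ler_wpM2l ?divr_ge0 ?ltW // ltrDl.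
have [|s [t [sh th E]]] := @second_difference_mvt f a u v h h0.
  by move=> s t sh th; have [? []] := dP _ (inB _ _ sh th).
have inB' s' t' : 0 <= s' <= h -> 0 <= t' <= h -> ball a d (a + s' *: v + t' *: u).
  by move=> s'h t'h; rewrite addrAC; exact: inB.
have [|s' [t' [s'h t'h E']]] := @second_difference_mvt f a v u h h0.
  by move=> ? ? sh' th'; have [? [_ []]] := dP _ (inB' _ _ sh' th').
(* The second difference is symmetric in [u] and [v], so the two mean values coincide. Each lies
   within [e / 2] of its own mixed derivative at [a], contradicting the gap [e]. *)
have EE : 'D_v ('D_u f) (a + s *: u + t *: v) = 'D_u ('D_v f) (a + s' *: v + t' *: u).
  apply: (mulfI (lt0r_neq0 h0)); apply: (mulfI (lt0r_neq0 h0)).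
  apply: etrans (esym E) (etrans _ E').
  by rewrite [a + h *: v + h *: u]addrAC [X in _ = X + _]addrAC.
have [_ [_ [_ [H1 _]]]] := dP _ (inB _ _ sh th).
have [_ [_ [_ [_ H2]]]] := dP _ (inB' _ _ s'h t'h).
have tri (A B x : R) : `|A - B| <= `|A - x| + `|B - x|.
  by rewrite (distrC B x); exact: ler_distD.
have : e < e / 2 + e / 2.
  by apply: le_lt_trans (tri _ _ _) (ltrD H1 _); rewrite EE.
by rewrite -splitr ltxx.
Qed.

(** Lists of at most two directions in [smooth_on] supply everything: differentiability of order two
    gives continuity of the mixed derivatives. *)
Lemma smooth_derive_swap (U : set V) (f : V -> R) (a u v : V) :
  open U -> U a -> smooth_on U f -> 'D_v ('D_u f) a = 'D_u ('D_v f) a.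
Proof.
move=> oU Ua sf; have nU : nbhs a U by exact: open_nbhs_nbhs.
apply: derive_swap.
- by apply: filterS nU => x Ux; exact: (sf [::]).
- by apply: filterS nU => x Ux; exact: (sf [:: u]).
- by apply: filterS nU => x Ux; exact: (sf [:: v]).
- by apply: differentiable_continuous; exact: (sf [:: v; u]).
- by apply: differentiable_continuous; exact: (sf [:: u; v]).
Qed.

End SecondDerivatives.

(** * The pairing, gradients and the symmetric Hessian *)

Section Pairing.
Variable R : realType.

Lemma pairingC m (p v : 'rV[R]_m) : pairing p v = pairing v p.
Proof. by apply: eq_bigr => i _; rewrite mulrC. Qed.

Lemma pairingDl m (p q v : 'rV[R]_m) : pairing (p + q) v = pairing p v + pairing q v.
Proof. by rewrite /pairing -big_split; apply: eq_bigr => i _; rewrite mxE mulrDl. Qed.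

Lemma pairingZl m (k : R) (p v : 'rV[R]_m) : pairing (k *: p) v = k * pairing p v.
Proof. by rewrite /pairing mulr_sumr; apply: eq_bigr => i _; rewrite mxE mulrA. Qed.

Lemma pairing_row_mx m1 m2 (p : 'rV[R]_(m1 + m2)) (a : 'rV[R]_m1) (b : 'rV[R]_m2) :
  pairing p (row_mx a b) = pairing (lsubmx p) a + pairing (rsubmx p) b.
Proof.
rewrite /pairing big_split_ord.
by congr (_ + _); apply: eq_bigr => i _; rewrite ?row_mxEl ?row_mxEr mxE.
Qed.

Lemma pairing_delta m (p : 'rV[R]_m) i : pairing p (delta_mx 0 i) = p 0 i.
Proof.
rewrite /pairing (bigD1 i) //= mxE !eqxx mulr1 big1 ?addr0 // => j ji.
by rewrite mxE (negbTE ji) andbF mulr0.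
Qed.

Lemma grad_eq m (f : 'rV[R]_m -> R) (a p : 'rV[R]_m) :
  (forall w, 'D_w f a = pairing p w) -> grad f a = p.
Proof. by move=> fp; apply/rowP => i; rewrite mxE fp pairing_delta. Qed.

(** Symmetry of the Hessian as a bilinear form: ['D_v (grad f) a] is the Hessian of [f] at [a]
    applied to [v]. *)
Lemma derive_grad_sym m (U : set 'rV[R]_m) (f : 'rV[R]_m -> R) (a p v : 'rV[R]_m) :
  open U -> U a -> smooth_on U f ->
  pairing p ('D_v (grad f) a) = pairing ('D_p (grad f) a) v.
Proof.
move=> oU Ua sf.
have gE i : (fun y => grad f y 0 i) = 'D_(delta_mx 0 i) f.
  by apply/funext => y; rewrite mxE.
have dg : differentiable (grad f) a.
  by apply: differentiable_mx => i j; rewrite ord1 gE; exact: (sf [:: _]).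
have swap u w : 'D_w ('D_u f) a = 'D_u ('D_w f) a.
  exact: smooth_derive_swap sf.
have pE u w : pairing u ('D_w (grad f) a) = 'D_u ('D_w f) a.
  rewrite derive_grad; last exact: (sf [:: w]).
  rewrite pairingC; apply: eq_bigr => i _; congr (_ * _).
  by rewrite derive_mxE // gE swap mxE.
by rewrite pE [RHS]pairingC pE swap.
Qed.

End Pairing.

(** * Changes of charts and covariance of the differential *)

Section Charts.
Variables (R : realType) (M : Type) (m : nat).

Lemma transition_near (c c' : chart R M m) (x : M) :
  is_chart c -> is_chart c' -> compatible c c' -> cdom c x -> cdom c' x ->
  \forall a \near c x, cinv c' (c' (cinv c a)) = cinv c a.
Proof.
move=> [_ cK] [_ cK'] [oU _] cx cx'.
have : nbhs (c x) (c @` (cdom c `&` cdom c')).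
  by apply: open_nbhs_nbhs; split => //; exists x.
by apply: filterS => _ [y [cy cy'] <-]; rewrite cK // cK'.
Qed.

Lemma transition_differentiable (c c' : chart R M m) (x : M) :
  compatible c c' -> cdom c x -> cdom c' x -> differentiable (c' \o cinv c) (c x).
Proof. by move=> [_ sU] cx cx'; apply: (sU [::]); exists x. Qed.

Variable A : atlas R M m.
Hypothesis hA : is_manifold A.

(** Since [smooth_fun] speaks only of charts of the atlas, while [c] is in the maximal one,
    [f \o cinv c] is factored near [c x] through [chart_at A x]. *)
Lemma smooth_fun_chart_differentiable (f : M -> R) (c : chart R M m) (x : M) :
  smooth_fun A f -> smooth_chart A c -> cdom c x ->
  differentiable (f \o cinv c) (c x).
Proof.
move=> sf [cc sc] cx; have [ch /(_ x)[Ax xx] _ _ _] := hA.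
have [c1 _] := sc _ Ax.
have nE := transition_near cc (ch _ Ax) c1 cx xx.
have df := transition_differentiable c1 cx xx.
apply: (@near_eq_differentiable _ _ _
  ((f \o cinv (chart_at A x)) \o (chart_at A x \o cinv c))).
  by apply: filterS nE => a /= ->.
apply: differentiable_comp => //=.
have [_ ->] := cc; last by [].
by apply: (sf _ Ax [::]); exists x.
Qed.

(** The chain rule for the transition from [c] to the distinguished chart, in which the components
    of the differential are stored. *)
Lemma covector_change_differential (f : M -> R) (c : chart R M m) (x : M) :
  smooth_fun A f -> charts A c -> cdom c x ->
  covector_change (chart_at A x) c x (differential A f x).2 = grad (f \o cinv c) (c x).
Proof.
move=> sf Ac cx; have [ch /(_ x)[Ax xx] co _ _] := hA.
have [cc cc'] := (ch _ Ac, ch _ Ax).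
have c1 := co _ _ Ac Ax.
have nE := transition_near cc cc' c1 cx xx.
have df := transition_differentiable c1 cx xx.
have cK : cinv c (c x) = x by have [_ ->] := cc.
apply/rowP => i; rewrite !mxE /=.
have dfx : differentiable (f \o cinv (chart_at A x)) (chart_at A x x).
  by apply: (sf _ Ax [::]); exists x.
rewrite -derive_grad //.
have := @derive_comp _ _ _ _ _ (f \o cinv (chart_at A x)) (c x) (delta_mx 0 i) df.
rewrite /= cK => /(_ dfx) <-; apply: near_eq_derive.
by apply: filterS nE => a /= ->.
Qed.

End Charts.

(** * The prolongation in Darboux coordinates and the dynamics over its image *)

Section ProlongedDynamics.
Variables (R : realType) (n k : nat) (Q : Type) (AQ : atlas R Q n).
Hypothesis hQ : is_manifold AQ.
Variable W : Q -> R.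
Hypothesis hW : smooth_fun AQ W.

Let Wc (c : chart R Q n) : 'rV[R]_n -> R := W \o cinv c.

(** The differential of [W] at each nearby point is stored in that point's own distinguished chart,
    which may vary abruptly; covariance turns it into the gradient in the fixed chart [c]. *)
Lemma prolong_near (c : chart R Q n) (x : Q) : charts AQ c -> cdom c x ->
  \forall a \near c x, darboux_chart AQ c (prolong AQ W (cinv c a)) =
    row_mx (row_mx a (grad (Wc c) a)) (const_mx (Wc c a)).
Proof.
move=> Ac cx; have [ch _ _ _ _] := hQ.
have [oU cK] := ch _ Ac.
have : nbhs (c x) (c @` cdom c) by apply: open_nbhs_nbhs; split => //; exists x.
apply: filterS => _ [y cy <-].
by rewrite /Wc -(covector_change_differential hQ hW Ac cy) /= (cK _ cy).
Qed.

Lemma differentiable_grad (c : chart R Q n) (x : Q) : charts AQ c -> cdom c x ->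
  differentiable (grad (Wc c)) (c x).
Proof.
move=> Ac cx; apply: differentiable_mx => i j.
have -> : (fun y => grad (Wc c) y i j) = 'D_(delta_mx 0 j) (Wc c).
  by apply/funext => y; rewrite mxE.
by apply: (hW Ac [:: _]); exists x.
Qed.

Let prolong_coords (c : chart R Q n) (a : 'rV[R]_n) : 'rV[R]_(n + n + 1) :=
  row_mx (row_mx a (grad (Wc c) a)) (const_mx (Wc c a)).

Lemma differentiable_prolong_coords (c : chart R Q n) (x : Q) :
  charts AQ c -> cdom c x -> differentiable (prolong_coords c) (c x).
Proof.
move=> Ac cx; apply: differentiable_row_mx.
  by apply: differentiable_row_mx => //; exact: differentiable_grad.
apply: differentiable_mx => i j; under eq_fun do rewrite mxE.
by apply: (hW Ac [::]); exists x.
Qed.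

Lemma differentiable_prolong_chart (c : chart R Q n) (x : Q) :
  charts AQ c -> cdom c x ->
  differentiable (darboux_chart AQ c \o prolong AQ W \o cinv c) (c x).
Proof.
move=> Ac cx; have := differentiable_prolong_coords Ac cx.
apply: near_eq_differentiable.
by apply: filterS (prolong_near Ac cx) => a; exact: esym.
Qed.

(** The last block says that zdot is p paired with qdot: vectors tangent to the prolongation are
    horizontal. *)
Lemma derive_prolong_chart (c : chart R Q n) (x : Q) (v : 'rV[R]_n) :
  charts AQ c -> cdom c x ->
  'D_v (darboux_chart AQ c \o prolong AQ W \o cinv c) (c x) =
  row_mx (row_mx v ('D_v (grad (Wc c)) (c x)))
         (const_mx (pairing (grad (Wc c) (c x)) v)).
Proof.
move=> Ac cx; have dW : differentiable (Wc c) (c x).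
  by apply: (hW Ac [::]); exists x.
have dp := differentiable_grad Ac cx.
have dc : differentiable (fun a => const_mx (Wc c a) : 'rV[R]_1) (c x).
  by apply: differentiable_mx => i j; under eq_fun do rewrite mxE.
rewrite (near_eq_derive v (prolong_near Ac cx)).
rewrite derive_row_mx //; last exact: differentiable_row_mx.
rewrite derive_row_mx // derive_id; congr row_mx.
apply/rowP => i; rewrite derive_mxE // mxE -derive_grad //.
by under eq_fun do rewrite mxE.
Qed.

Lemma tangent_map_prolong (x : Q) (v : 'rV[R]_n) :
  let p := momentum (prolong AQ W x) in
  let c := chart_at AQ x in
  tangent_map AQ (extcot_atlas AQ) (prolong AQ W) (x, v) =
  (prolong AQ W x, row_mx (row_mx v ('D_v (grad (Wc c)) (c x))) (const_mx (pairing p v))).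
Proof.
have [_ /(_ x)[Ac cx] _ _ _] := hQ.
rewrite /= -(derive_prolong_chart _ Ac cx) deriveE //.
exact: differentiable_prolong_chart.
Qed.

Variables (P : Type) (AP : atlas R P (n + n + 1 + k)) (tau : P -> extcot R n Q).
Hypothesis hP : is_manifold AP.
Variable F : P -> R.
Hypothesis hF : smooth_fun AP F.

(** The chain rule produces the transposed Hessian on [dF_p]; symmetry replaces it by the derivative
    of the gradient along [dF_p]. *)
Lemma grad_F_prolong (x : Q) (y : P) (psi : chart R P (n + n + 1 + k)) :
  let p := momentum (prolong AQ W x) in
  let c := chart_at AQ x in
  tau y = prolong AQ W x -> bundle_chart AQ AP tau c psi y ->
  grad (F_prolong AQ F W c psi) (row_mx (c x) (rsubmx (psi y))) =
  row_mx (dF_q F psi y + 'D_(dF_p F psi y) (grad (Wc c)) (c x) + dF_z F psi y *: p)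
         (dF_lambda F psi y).
Proof.
move=> p c ty [spsi psiy bpsi].
have [ch /(_ x)[Ac cx] _ _ _] := hQ.
have cK : cinv c (c x) = x by have [_ ->] := ch _ Ac.
have dF := smooth_fun_chart_differentiable hP hF spsi psiy.
pose G := darboux_chart AQ c \o prolong AQ W \o cinv c.
have dG : differentiable G (c x) by exact: differentiable_prolong_chart.
set s0 := row_mx _ _.
(* [H] sends (q, lambda) to the bundle coordinates over the prolongation, so [F_prolong] is
   [(F \o cinv psi) \o H]. *)
pose H (s : 'rV[R]_(n + k)) := row_mx (G (lsubmx s)) (rsubmx s).
have dl : differentiable (lsubmx : 'rV[R]_(n + k) -> 'rV[R]_n) s0.
  exact: differentiable_lsubmx.
have dr : differentiable (rsubmx : 'rV[R]_(n + k) -> 'rV[R]_k) s0.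
  exact: differentiable_rsubmx.
have dGl : differentiable (G \o lsubmx) s0.
  by apply: differentiable_comp; rewrite ?row_mxKl.
have dH : differentiable H s0 by exact: differentiable_row_mx.
have Hs0 : H s0 = psi y.
  have Gcx : G (c x) = lsubmx (psi y).
    by have [_ ->] := bpsi _ psiy; rewrite ty /G [LHS]/comp cK.
  by rewrite /H row_mxKl row_mxKr Gcx hsubmxK.
have DH w : 'D_w H s0 = row_mx ('D_(lsubmx w) G (c x)) (rsubmx w).
  have Dl : 'D_w (lsubmx : 'rV[R]_(n + k) -> 'rV[R]_n) s0 = lsubmx w.
    by rewrite deriveE // diff_lin //; exact: continuous_lsubmx.
  have Dr : 'D_w (rsubmx : 'rV[R]_(n + k) -> 'rV[R]_k) s0 = rsubmx w.
    by rewrite deriveE // diff_lin //; exact: continuous_rsubmx.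
  have dG0 : differentiable G (lsubmx s0) by rewrite row_mxKl.
  have Dc := derive_comp w dl dG0.
  by rewrite (derive_row_mx w dGl dr) Dr Dc Dl row_mxKl.
apply: grad_eq => w.
rewrite -[F_prolong _ _ _ _ _]/((F \o cinv psi) \o H).
rewrite derive_comp ?Hs0 // derive_grad // DH derive_prolong_chart //.
rewrite -[w in RHS](hsubmxK w) !pairing_row_mx row_mxKl row_mxKr.
congr (_ + _); rewrite !pairingDl pairingZl.
have oU : open (c @` cdom c) by have [] := ch _ Ac.
rewrite -(derive_grad_sym _ _ oU _ (hW Ac)); last by exists x.
congr (_ + _); rewrite /pairing big_ord1; congr (_ * _).
exact: mxE.
Qed.

(** Horizontality determines zdot, so an element is fixed by [x], [y] and [psi]; this makes the
    restriction a parametrized set. *)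
Lemma restrictedP (Xu : T_extcot R n Q * R) :
  restricted AQ AP tau F W Xu <-> exists x y psi,
    let p := momentum (prolong AQ W x) in
    [/\ tau y = prolong AQ W x, bundle_chart AQ AP tau (chart_at AQ x) psi y,
        dF_lambda F psi y = 0 &
        Xu = (prolong AQ W x,
              row_mx (row_mx (dF_p F psi y) (- dF_q F psi y - dF_z F psi y *: p))
                     (const_mx (pairing p (dF_p F psi y))),
              dF_z F psi y)].
Proof.
split=> [[] | [x [y [psi [ty bpsi l0 ->]]]]]; last first.
  split; last by exists x.
  split=> /=.
    rewrite /horizontal /= /contact_form /= /zpart /qpart.
    by rewrite row_mxKr mxE !row_mxKl subrr.
  exists y, psi; split => //=.
  by rewrite /qpart /ppart !row_mxKl row_mxKr.
case: Xu => [[w X] u] /= [hor [y [psi [ty bpsi l0 [Xq Xp Xu]]]]] [x _ xw].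
rewrite /= -xw in hor ty bpsi Xp Xq Xu *.
exists x, y, psi; split => //; rewrite Xu; congr (_, _, _).
rewrite -Xp -Xq /qpart /ppart hsubmxK -[X in LHS]hsubmxK; congr row_mx.
by apply/rowP => i; rewrite ord1 [RHS]mxE; exact: subr0_eq hor.
Qed.

End ProlongedDynamics.

(** * Equivalence of the relation and the Hamilton-Jacobi equation *)

Theorem theorem4p5 (R : realType) (n k : nat)
  (Q : Type) (AQ : atlas R Q n) (hQ : is_manifold AQ)
  (P : Type) (AP : atlas R P (n + n + 1 + k)) (hP : is_manifold AP)
  (T : Type) (AT : atlas R T k) (hT : is_manifold AT)
  (tau : P -> extcot R n Q) (htau : fiber_bundle AP (extcot_atlas AQ) AT tau)
  (F : P -> R) (hF : morse_family AP (extcot_atlas AQ) tau F)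
  (W : Q -> R) (hW : smooth_fun AQ W) :
  prolong_related AQ AP tau F W <-> hamilton_jacobi AQ AP tau F W.
Proof.
have [sF _] := hF.
pose p x := momentum (prolong AQ W x).
pose X x y (psi : chart R P (n + n + 1 + k)) : T_extcot R n Q := (prolong AQ W x,
  row_mx (row_mx (dF_p F psi y) (- dF_q F psi y - dF_z F psi y *: p x))
         (const_mx (pairing (p x) (dF_p F psi y)))).
pose hess x v := 'D_v (grad (W \o cinv (chart_at AQ x))) (chart_at AQ x x).
pose S x y psi := [/\ tau y = prolong AQ W x,
  bundle_chart AQ AP tau (chart_at AQ x) psi y & dF_lambda F psi y = 0].
(* Both sides of the relation are written as images of the same triples [S x y psi], to be compared
   pointwise. *)
have restrE : fst @` restricted AQ AP tau F W =
    [set Y | exists x y psi, S x y psi /\ Y = X x y psi].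
  apply/seteqP; split => Y /=.
    by move=> [_ /restrictedP[x [y [psi [ty b l ->]]]] <-]; exists x, y, psi.
  move=> [x [y [psi [[ty b l] ->]]]].
  by exists (X x y psi, dF_z F psi y) => //; apply/restrictedP; exists x, y, psi.
have projE : tangent_map AQ (extcot_atlas AQ) (prolong AQ W) @`
      projected AQ AP tau F W =
    [set Y | exists x y psi, S x y psi /\
       Y = tangent_map AQ (extcot_atlas AQ) (prolong AQ W) (x, dF_p F psi y)].
  apply/seteqP; split => Y /=.
    move=> [_ [_ /restrictedP[x [y [psi [ty b l ->]]]] <-] <-].
    exists x, y, psi; split => //.
    by rewrite /to_TQ /qpart /= !row_mxKl.
  move=> [x [y [psi [[ty b l] ->]]]].
  exists (x, dF_p F psi y) => //; exists (X x y psi, dF_z F psi y).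
    by apply/restrictedP; exists x, y, psi.
  by rewrite /to_TQ /qpart /= !row_mxKl.
rewrite /prolong_related restrE projE.
have tmE x v : tangent_map AQ (extcot_atlas AQ) (prolong AQ W) (x, v) =
    (prolong AQ W x, row_mx (row_mx v (hess x v)) (const_mx (pairing (p x) v))).
  exact: tangent_map_prolong.
have hjE x y psi : S x y psi ->
  grad (F_prolong AQ F W (chart_at AQ x) psi)
       (row_mx (chart_at AQ x x) (rsubmx (psi y))) = 0 <->
  hess x (dF_p F psi y) = - dF_q F psi y - dF_z F psi y *: p x.
  move=> [ty b l]; rewrite (grad_F_prolong hQ hW hP sF ty b) l.
  rewrite -[0 in RHS](@row_mx0 R 1 n k).
  split => [/eq_row_mx[/eqP + _] | E].
    by rewrite addrAC addr_eq0 => /eqP; rewrite -opprD => ->; rewrite opprK.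
  by rewrite -/(hess x (dF_p F psi y)) E addrA subrr sub0r addNr.
split=> [E x y psi ty b l | HJ].
  have Sx : S x y psi by [].
  apply/hjE => //.
  have : [set Y | exists x y psi, S x y psi /\ Y = X x y psi] (X x y psi).
    by exists x, y, psi.
  (* Equality of sets yields only some triple, with possibly different [y'] and [psi']. The base
     point forces [x' = x] and the qdot block forces equal [dF_p], so the pdot block gives the
     Hessian identity for [y] itself. *)
  rewrite -E => -[x' [y' [psi' [_]]]]; rewrite tmE => XE.
  have xx' : x = x' := congr1 (fun Y : T_extcot R n Q => base_pt Y.1) XE.
  move: XE; rewrite -xx' => /(congr1 snd) /= /eq_row_mx[/eq_row_mx[qE pE] _].
  by rewrite qE -pE.
(* The same triple serves in both inclusions: the qdot and zdot blocks already agree, and the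
   equation matches the pdot blocks. *)
apply/seteqP; split => _ [x [y [psi [Sx ->]]]]; exists x, y, psi; split => //;
  by have [ty b l] := Sx; rewrite tmE; move/hjE: (HJ _ _ _ ty b l) => /(_ Sx) ->.
Qed.
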